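(* Let $\mathcal{T}$ be a radial grid with line resistances $r_{ef}$ and reactances $x_{ef}$, with nodal voltage magnitudes $v$ given by the linear coupled power flow model from random injections $p,q$ that are uncorrelated across distinct nodes. Let node $b$ be the parent of two distinct nodes $a$ and $c$ in $\mathcal{T}$, so that $(ab)$ and $(bc)$ are operational edges. Then $$\phi_{ac}=\sum_{d\in\mathcal{D}_a}\left(r_{ab}^2\,\Omega_p(d,d)+x_{ab}^2\,\Omega_q(d,d)+2r_{ab}x_{ab}\,\Omega_{pq}(d,d)\right)+\sum_{d\in\mathcal{D}_c}\left(r_{bc}^2\,\Omega_p(d,d)+x_{bc}^2\,\Omega_q(d,d)+2r_{bc}x_{bc}\,\Omega_{pq}(d,d)\right),$$ and moreover $$\phi_{ac}=\phi_{ab}+\phi_{bc}.$$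
   Context: Radial grid: $\mathcal{T}$ is a finite tree with node set $\mathcal{V}^{\mathcal{T}}$ and (operational) undirected edge set $\mathcal{E}^{\mathcal{T}}$, rooted at a distinguished node (the substation, or reference node). Each edge $(ef)\in\mathcal{E}^{\mathcal{T}}$ has a resistance $r_{ef}>0$ and a reactance $x_{ef}>0$. For a node $a$, $\mathcal{P}_a$ denotes the set of edges on the unique path from $a$ to the root. A node $c$ is a descendant of $a$ if the path from $c$ to the root passes through $a$. $\mathcal{D}_a$ is the set of descendants of $a$, with $a\in\mathcal{D}_a$. If $(ac)\in\mathcal{E}^{\mathcal{T}}$ and $c$ is a descendant of $a$, then $a$ is the parent of $c$ and $c$ is a child of $a$. Linear coupled power flow (LC-PF) model: let $p,q,v$ be the vectors, indexed by the non-root nodes, of active power injections, reactive power injections and voltage magnitudes (the latter measured relative to the reference node). Let $H_{1/r}$ (respectively $H_{1/x}$) be the reduced weighted Laplacian of $\mathcal{T}$: the weighted graph Laplacian with edge weights $1/r_{ef}$ (respectively $1/x_{ef}$) with the row and column of the root removed. Then $$v=H_{1/r}^{-1}p+H_{1/x}^{-1}q.$$ The root's voltage magnitude is a deterministic constant. Statistics: $p$ and $q$ are real random vectors with finite second moments. For random vectors $X,Y$, $\mu_X=\mathbb{E}[X]$ and $\Omega_{XY}=\mathbb{E}[(X-\mu_X)(Y-\mu_Y)^T]$, with $\Omega_X=\Omega_{XX}$. Standing assumption: for all non-root nodes $e\neq f$, $\Omega_p(e,f)=\Omega_q(e,f)=\Omega_{qp}(e,f)=0$. For two nodes $e,f$,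 define $\phi_{ef}=\mathbb{E}\left[\left((v_e-\mu_{v_e})-(v_f-\mu_{v_f})\right)^2\right]$, the variance of the difference of voltage magnitudes at $e$ and $f$. *)

(* Defs.v *)
(* MathComp / MathComp-Analysis *)
From HB Require Import structures.
From mathcomp Require Import all_boot all_order all_algebra.
From mathcomp Require Import all_classical all_reals all_analysis.
Set Implicit Arguments.
Unset Strict Implicit.
Unset Printing Implicit Defensive.
Import Order.TTheory GRing.Theory Num.Theory.
Local Open Scope ring_scope.

(* A rooted tree with positive symmetric edge parameters. The values of
   resistance and reactance on non-adjacent pairs are irrelevant. Cycles of
   size 2 (going back and forth along one edge) are not graph cycles. *)
Record radial_grid (R : realType) (V : finType) := RadialGrid {
  edge : rel V;
  substation : V;
  resistance : V -> V -> R;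
  reactance : V -> V -> R;
  edge_sym : symmetric edge;
  edge_irr : irreflexive edge;
  grid_connected : forall a b, connect edge a b;
  grid_acyclic : forall s : seq V, ucycle edge s -> (size s <= 2)%N;
  resistance_sym : forall a b, edge a b -> resistance a b = resistance b a;
  reactance_sym : forall a b, edge a b -> reactance a b = reactance b a;
  resistance_gt0 : forall a b, edge a b -> 0 < resistance a b;
  reactance_gt0 : forall a b, edge a b -> 0 < reactance a b
}.

Definition simple_path (V : finType) (e : rel V) (a b : V) (s : seq V) : bool :=
  [&& path e a s, last a s == b & uniq (a :: s)].

(* In a tree the simple path from c to the root is unique, so "some" and
   "the" simple path agree. *)
Definition descendants (R : realType) (V : finType) (G : radial_grid R V)
    (a : V) : {set V} :=
  [set c | `[< exists s : seq V,
                 simple_path (edge G) c (substation G) s /\ a \in c :: s >]].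

Definition is_parent (R : realType) (V : finType) (G : radial_grid R V)
    (b a : V) : bool :=
  edge G b a && (a \in descendants G b).

Definition laplacian (R : realType) (V : finType) (e : rel V)
    (w : V -> V -> R) : 'M[R]_#|V| :=
  \matrix_(i, j)
    if i == j then \sum_(k | e (enum_val i) k) w (enum_val i) k
    else if e (enum_val i) (enum_val j) then - w (enum_val i) (enum_val j)
    else 0.

Definition reduced_laplacian (R : realType) (V : finType)
    (G : radial_grid R V) (w : V -> V -> R) : 'M[R]_#|V|.-1 :=
  row' (enum_rank (substation G)) (col' (enum_rank (substation G)) (laplacian (edge G) w)).

(* The k-th non-root node, in the row order of reduced_laplacian. *)
Definition nonroot_node (R : realType) (V : finType) (G : radial_grid R V)
    (k : 'I_#|V|.-1) : V :=
  enum_val (lift (enum_rank (substation G)) k).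

Definition nonroot_vec (R : realType) (V : finType) (G : radial_grid R V)
    (u : V -> R) : 'cV[R]_#|V|.-1 :=
  \col_k u (nonroot_node G k).

(* Linear coupled power flow: voltages are measured relative to the constant
   voltage v0 of the root; injections at the root do not occur. *)
Definition LCPF (R : realType) (V : finType) (G : radial_grid R V) (v0 : R)
    (p q v : V -> R) : Prop :=
  v (substation G) = v0 /\
  nonroot_vec G (fun a => v a - v0) =
    invmx (reduced_laplacian G (fun a b => (resistance G a b)^-1))
      *m nonroot_vec G p
    + invmx (reduced_laplacian G (fun a b => (reactance G a b)^-1))
      *m nonroot_vec G q.

Definition crosscov (d : measure_display) (T : measurableType d)
    (R : realType) (P : probability T R) (V : finType) (X Y : V -> T -> R)
    (e f : V) : \bar R :=
  covariance P (X e) (Y f).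

Definition phi (d : measure_display) (T : measurableType d) (R : realType)
    (P : probability T R) (V : finType) (v : V -> T -> R) (e f : V) : \bar R :=
  let mu a := fine 'E_P[v a]%E in
  'E_P[fun w => (((v e w - mu e) - (v f w - mu f)) ^+ 2)%R]%E.

(* Main.v *)
(* Summing the Laplacian equation H u = g over the subtree of descendants of a
   leaves only the flow through the edge from a to its parent b, so that
   w_ab (u_a - u_b) is the total injection of g in the subtree. With g = 0 this
   makes H injective, hence invertible; in general it gives v_a - v_b as the sum
   of r_ab p_d + x_ab q_d over the descendants d of a. These summands are
   uncorrelated for distinct d, and siblings a, c have disjoint subtrees, so
   v_a - v_b and v_c - v_b are uncorrelated and the variances add up. *)
Require Import Defs.
From HB Require Import structures.
From mathcomp Require Import all_boot all_order all_algebra.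
From mathcomp Require Import all_classical all_reals all_analysis.
Import Order.TTheory GRing.Theory Num.Theory.
Local Open Scope ring_scope.
Set Implicit Arguments.
Unset Strict Implicit.
Unset Printing Implicit Defensive.

(** * Simple paths and descendants in a rooted tree *)

Definition edge_avoiding (V : finType) (e : rel V) (x : V) : rel V :=
  fun y z => [&& e y z, y != x & z != x].

Lemma connect_avoiding (V : finType) (e : rel V) (x y z : V) (s : seq V) :
  simple_path e y z s -> x \notin y :: s -> connect (edge_avoiding e x) y z.
Proof.
case/and3P=> es /eqP <- _ xs; apply/connectP; exists s => //.
elim: s y es xs => [|t s IHs] y //= /andP[eyt es].
rewrite inE negb_or => /andP[xy xts].
rewrite /edge_avoiding eyt [y == x]eq_sym xy -/(edge_avoiding e x) IHs // andbT.
by move: xts; rewrite inE negb_or => /andP[]; rewrite eq_sym.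
Qed.

Section Tree.
Context (R : realType) (V : finType) (G : radial_grid R V).
Local Notation e := (edge G).
Local Notation root := (substation G).

(* Distinct neighbours of x joined by a path avoiding x would close a cycle of
   length at least 3. *)
Lemma neighbor_unique (x s t : V) :
  e x s -> e x t -> connect (edge_avoiding e x) s t -> s = t.
Proof.
move=> exs ext /connectP[r0 /shortenP[r er ur _] tE].
have eer : path e s r by apply: sub_path er => y z /= /and3P[].
have xr : x \notin s :: r.
  have sx : s != x by apply: contraTneq exs => ->; rewrite edge_irr.
  elim: r s sx er {exs ur tE eer} => [|z r IHr] s sx /=; rewrite inE eq_sym.
    by rewrite (negPf sx).
  by case/andP=> /and3P[_ _ zx] /(IHr _ zx); rewrite (negPf sx).
have: ucycle e (x :: s :: r).
  rewrite /ucycle /= exs rcons_path eer /= -tE edge_sym ext /=.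
  by rewrite xr; move: ur => /= ->.
(* The bound 2 on the length of [x :: s :: r] forces [r] to be empty, so that its endpoint [t] is
   [s]. *)
by move/grid_acyclic; case: r tE {er ur eer xr}.
Qed.

(** Induction along the path: the first steps from [x] both reach [y] without returning to [x],
    hence are connected away from [x], and [neighbor_unique] identifies them. *)
Lemma simple_path_unique (x y : V) (s t : seq V) :
  simple_path e x y s -> simple_path e x y t -> s = t.
Proof.
elim: s x t => [|s0 s IHs] x [|t0 t] //.
- by case/and3P=> _ /eqP <- _ /and3P[_ /= /eqP lt]; rewrite -{1}lt mem_last.
- by case/and3P=> _ /= /eqP ls us /and3P[_ /= /eqP xy _]; move: us;
    rewrite xy -ls mem_last.
case/and3P=> /= /andP[exs es] ls /andP[xs us].
case/and3P=> /= /andP[ext et] lt /andP[xt ut].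
have sP : simple_path e s0 y s by apply/and3P.
have tP : simple_path e t0 y t by apply/and3P.
have avoid_sym : connect_sym (edge_avoiding e x).
  apply: sym_connect_sym => u w.
  by rewrite /edge_avoiding edge_sym andbA andbAC -andbA.
have st : s0 = t0.
  apply: (neighbor_unique exs ext).
  apply: connect_trans (connect_avoiding sP xs) _.
  by rewrite avoid_sym; apply: connect_avoiding tP xt.
by rewrite st in sP *; rewrite (IHs _ _ sP tP).
Qed.

Lemma root_path_exists (a : V) : exists s, simple_path e a root s.
Proof.
have /connectP[s0 /shortenP[s es us _] sE] := grid_connected G a root.
by exists s; apply/and3P; split=> //; apply/eqP.
Qed.

Definition root_path (a : V) : seq V := xchoose (root_path_exists a).

Lemma root_pathP (a : V) : simple_path e a root (root_path a).
Proof. exact: xchooseP. Qed.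

Lemma root_path_unique (a : V) (s : seq V) :
  simple_path e a root s -> root_path a = s.
Proof. exact/simple_path_unique/root_pathP. Qed.

Lemma mem_descendants (a d : V) :
  (d \in descendants G a) = (a \in d :: root_path d).
Proof.
rewrite inE; apply/asboolP/idP => [[s [/root_path_unique -> //]]|ad].
by exists (root_path d); split=> //; apply: root_pathP.
Qed.

(** Cutting the path of [d] at [a] leaves a simple path from [a] to the root, which by uniqueness is
    the path of [a]. *)
Lemma root_path_suffix (a d : V) : d \in descendants G a ->
  exists s, d :: root_path d = s ++ a :: root_path a.
Proof.
rewrite mem_descendants; case/and3P: (root_pathP d) => er lr ur ad.
move def_r: (d :: root_path d) ad => r ad; case/splitPr: ad def_r => s t def_r.
exists s; congr (_ ++ _ :: _); symmetry.
apply: root_path_unique.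
have := ur; rewrite def_r cat_uniq => /and3P[_ _ uat].
case: s def_r => [|d' s] [dE rE].
  by rewrite -dE -rE in uat *; apply/and3P; split.
move: er lr; rewrite rE cat_path last_cat /= => /and3P[_ _ et] lt.
by apply/and3P; split.
Qed.

(** If [k] is on the path of [d], then [d] is not on the path of [k], which can be extended by the
    edge to [d]; otherwise the path of [d] can be extended to [k]. Uniqueness concludes. *)
Lemma root_path_edge (d k : V) : e d k ->
  root_path d = k :: root_path k \/ root_path k = d :: root_path d.
Proof.
move=> edk; case/and3P: (root_pathP d) => er lr ur.
have [kd|kd] := boolP (k \in d :: root_path d).
  left; rewrite -mem_descendants in kd.
  have [s sE] := root_path_suffix kd.
  have dk : d \notin k :: root_path k.
    case: s sE => [|d' s] [dE rE]; first by rewrite dE edge_irr in edk.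
    by apply: contraL ur => dk; rewrite /= rE mem_cat dk orbT.
  apply: root_path_unique; case/and3P: (root_pathP k) => ek lk uk.
  by apply/and3P; split; rewrite //= ?edk //= dk.
right; apply: root_path_unique; apply/and3P; split; rewrite //= ?kd //.
by rewrite edge_sym edk.
Qed.

Lemma root_path_root : root_path root = [::].
Proof. by apply: root_path_unique; apply/and3P; split=> /=. Qed.

(** The other orientation of the edge would make the path of [b] visit [b] twice. This equation
    drives the later inductions on distance to the root. *)
Lemma root_path_parent (a b : V) :
  is_parent G b a -> root_path a = b :: root_path b.
Proof.
case/andP=> eba; rewrite mem_descendants inE => /orP[/eqP ab|bra].
  by rewrite ab edge_irr in eba.
have [|//] := root_path_edge eba => rb.
case/and3P: (root_pathP b) => _ _; rewrite rb /= inE.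
by rewrite bra orbT.
Qed.

Lemma child_neq_root (a b : V) : is_parent G b a -> a != root.
Proof.
by move/root_path_parent; apply: contra_eq_neq => ->; rewrite root_path_root.
Qed.

Lemma descendant_neq_root (a b d : V) :
  is_parent G b a -> d \in descendants G a -> d != root.
Proof.
move=> /child_neq_root a_root; rewrite mem_descendants.
by apply: contraTneq => ->; rewrite root_path_root inE.
Qed.

Lemma descendants_refl (a : V) : a \in descendants G a.
Proof. by rewrite mem_descendants mem_head. Qed.

Lemma parent_notin_descendants (a b : V) :
  is_parent G b a -> b \notin descendants G a.
Proof.
move/root_path_parent => ra; rewrite mem_descendants -ra.
by case/and3P: (root_pathP a) => _ _ /andP[].
Qed.

(** By [root_path_edge] one of [d], [k] precedes the other. If [d] came after [k], then [k] would
    inherit [a] on its path; so [k] follows [d], and [a], absent from the path of [k], can only be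
    [d]. *)
Lemma descendants_boundary (a b d k : V) : is_parent G b a ->
  d \in descendants G a -> k \notin descendants G a -> e d k ->
  d = a /\ k = b.
Proof.
move=> /root_path_parent ra; rewrite !mem_descendants => ad ak edk.
case: (root_path_edge edk) => [rd|rk]; last first.
  by move: ak; rewrite rk inE ad orbT.
move: ad; rewrite rd inE (negPf ak) orbF => /eqP ad.
by split=> //; move: ra; rewrite ad rd => -[].
Qed.

(** The path of [d] ends both in [a] and in [c] followed by the path from [b]; suffixes of equal
    length coincide. *)
Lemma descendants_siblings (a b c d : V) : is_parent G b a -> is_parent G b c ->
  d \in descendants G a -> d \in descendants G c -> a = c.
Proof.
move=> /root_path_parent ra /root_path_parent rc.
move=> /root_path_suffix[s ds] /root_path_suffix[t]; rewrite ds ra rc => st.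
have eq_size_st : size s = size t.
  by move/(congr1 size): st; rewrite !size_cat /= => /addIn.
by move/eqP: st; rewrite eqseq_cat // => /andP[_ /eqP[]].
Qed.

Lemma exists_parent (a : V) : a != root -> exists b, is_parent G b a.
Proof.
move=> a_root; case rE: (root_path a) (root_pathP a) => [|b s] /and3P[/= ea la ua].
  by rewrite la in a_root.
exists b; apply/andP; split; first by rewrite edge_sym; case/andP: ea.
by rewrite mem_descendants rE !inE eqxx orbT.
Qed.

End Tree.

(** * Laplacians, flows and voltage drops *)

Section Flow.
Context (R : realType) (V : finType) (G : radial_grid R V).
Local Notation e := (edge G).
Local Notation root := (substation G).

Definition net_outflow (w : V -> V -> R) (u : V -> R) (d : V) : R :=
  \sum_(k | e d k) w d k * (u d - u k).

(* Flows along edges inside the subtree cancel, and the only edge leaving it is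
   the one from [a] to its parent. *)
Lemma sum_net_outflow (w : V -> V -> R) (u : V -> R) (a b : V) :
  (forall d k, e d k -> w d k = w k d) -> is_parent G b a ->
  \sum_(d in descendants G a) net_outflow w u d = w a b * (u a - u b).
Proof.
move=> w_sym ba; set D := descendants G a.
have -> : \sum_(d in D) net_outflow w u d =
    \sum_(d in D) \sum_(k in D | e d k) w d k * (u d - u k) +
    \sum_(d in D) \sum_(k | (k \notin D) && e d k) w d k * (u d - u k).
  rewrite -big_split /=; apply: eq_bigr => d _.
  rewrite /net_outflow (bigID (mem D)) /=.
  by congr (_ + _); apply: eq_bigl => k; rewrite andbC.
(* Exchanging the endpoints of each inner edge changes the sign of its term, so [S = - S]. *)
set S := (X in X + _); have S0 : S = 0.
  have : S = - S.
    rewrite {1}/S (exchange_big_dep (mem D)) /=; last by move=> ? ? _ /andP[].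
    rewrite -sumrN; apply: eq_bigr => k kD; rewrite -sumrN.
    apply: eq_big => [d|d /and3P[_ _ edk]]; first by rewrite kD edge_sym.
    by rewrite (w_sym _ _ edk) -mulrN opprB.
  by move/eqP; rewrite -subr_eq0 opprK -mulr2n mulrn_eq0 => /eqP.
rewrite S0 add0r (bigD1 a) ?descendants_refl //= [X in _ + X]big1 ?addr0.
  rewrite (bigD1 b) /=; last first.
    by rewrite parent_notin_descendants // edge_sym; case/andP: ba.
  rewrite big1 ?addr0 // => k /andP[/andP[kD eak] kb].
  have [_ kE] := descendants_boundary ba (descendants_refl G a) kD eak.
  by rewrite kE eqxx in kb.
move=> d /andP[dD da]; apply: big1 => k /andP[kD edk].
by have [dE _] := descendants_boundary ba dD kD edk; rewrite dE eqxx in da.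
Qed.

Lemma laplacian_net_outflow (w : V -> V -> R) (u : V -> R) (i : 'I_#|V|) :
  \sum_j laplacian e w i j * u (enum_val j) = net_outflow w u (enum_val i).
Proof.
set x := enum_val i.
rewrite (reindex enum_rank) /=; last by apply: onW_bij; apply: enum_rank_bij.
rewrite (bigD1 x) //= enum_rankK mxE enum_valK eqxx -/x.
rewrite /net_outflow; under [RHS]eq_bigr do rewrite mulrBr.
rewrite sumrB -mulr_suml; congr (_ + _); rewrite -sumrN.
rewrite [RHS]big_mkcond [LHS]big_mkcond /=; apply: eq_bigr => y _.
rewrite mxE !enum_rankK -/x -(inj_eq enum_val_inj) enum_rankK -/x eq_sym.
have [->|yx] /= := eqVneq x y; first by rewrite edge_irr.
by case: ifP => _; rewrite ?mul0r ?mulNr.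
Qed.

(** Extends a reduced vector by potential 0 at the root, so that the deleted Laplacian column
    contributes nothing. *)
Definition grounded (z : 'cV[R]_#|V|.-1) (a : V) : R :=
  if unlift (enum_rank root) (enum_rank a) is Some k then z k 0 else 0.

Lemma grounded_root (z : 'cV[R]_#|V|.-1) : grounded z root = 0.
Proof. by rewrite /grounded unlift_none. Qed.

Lemma grounded_node (z : 'cV[R]_#|V|.-1) (k : 'I_#|V|.-1) :
  grounded z (nonroot_node G k) = z k 0.
Proof. by rewrite /grounded /nonroot_node enum_valK liftK. Qed.

Lemma nonroot_nodeP (a : V) : a != root -> exists k, a = nonroot_node G k.
Proof.
move=> a_root; have rk : enum_rank root != enum_rank a.
  by rewrite (inj_eq enum_rank_inj) eq_sym.
have [k kE _] := unlift_some rk.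
by exists k; rewrite /nonroot_node -kE enum_rankK.
Qed.

Lemma reduced_laplacian_net_outflow (w : V -> V -> R) (z : 'cV[R]_#|V|.-1) k :
  (reduced_laplacian G w *m z) k 0 =
  net_outflow w (grounded z) (nonroot_node G k).
Proof.
rewrite -laplacian_net_outflow (bigD1_ord (enum_rank root)) //=.
rewrite enum_rankK grounded_root mulr0 add0r mxE.
by apply: eq_bigr => j _; rewrite -grounded_node !mxE.
Qed.

(** The root is not below [a], so every node of the subtree has a row in the reduced system, and
    these rows can be summed with [sum_net_outflow]. *)
Lemma potential_drop (w : V -> V -> R) (z : 'cV[R]_#|V|.-1) (g : V -> R) (a b : V) :
  (forall d k, e d k -> w d k = w k d) -> (forall d k, e d k -> 0 < w d k) ->
  reduced_laplacian G w *m z = nonroot_vec G g -> is_parent G b a ->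
  grounded z a - grounded z b = (w a b)^-1 * \sum_(d in descendants G a) g d.
Proof.
move=> w_sym w_gt0 zE ba.
have wab : w a b != 0 by rewrite gt_eqF // w_gt0 // edge_sym; case/andP: ba.
apply: (mulfI wab); rewrite mulrA mulfV // mul1r -sum_net_outflow //.
apply: eq_bigr => d /(descendant_neq_root ba) /nonroot_nodeP[k ->].
by rewrite -reduced_laplacian_net_outflow zE mxE.
Qed.

(** A kernel vector has zero drop between each node and its parent, and it vanishes at the root,
    hence everywhere by induction on depth. *)
Lemma reduced_laplacian_unit (w : V -> V -> R) :
  (forall d k, e d k -> w d k = w k d) -> (forall d k, e d k -> 0 < w d k) ->
  reduced_laplacian G w \in unitmx.
Proof.
(* [det0P] yields a row vector in the left kernel; passing to the transpose makes it a right kernel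
   vector. *)
move=> w_sym w_gt0; rewrite -unitmx_tr unitmxE unitfE.
apply/det0P => -[z z_neq0 zH]; case/eqP: z_neq0.
have Hz : reduced_laplacian G w *m z^T = nonroot_vec G (fun=> 0).
  by rewrite -[LHS]trmxK trmx_mul trmxK zH; apply/matrixP => i j; rewrite !mxE.
suff u0 a : grounded z^T a = 0.
  by apply/rowP => k; rewrite -[z]trmxK mxE -grounded_node u0 mxE.
have [n] := ubnP (size (root_path G a)); elim: n a => // n IHn a.
have [->|/exists_parent[b ba]] := eqVneq a root; first by rewrite grounded_root.
rewrite (root_path_parent ba) ltnS => /IHn ub.
have /eqP := potential_drop w_sym w_gt0 Hz ba.
by rewrite ub subr0 big1 // mulr0 => /eqP.
Qed.

Lemma LCPF_voltage_drop (v0 : R) (p q v : V -> R) (a b : V) :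
  LCPF G v0 p q v -> is_parent G b a ->
  v a - v b = resistance G a b * (\sum_(d in descendants G a) p d)
            + reactance G a b * (\sum_(d in descendants G a) q d).
Proof.
move=> [v_root vE] ba.
set zp := invmx _ *m nonroot_vec G p in vE.
set zq := invmx _ *m nonroot_vec G q in vE.
have {}vE d : v d = v0 + (grounded zp d + grounded zq d).
  have [->|/nonroot_nodeP[k ->]] := eqVneq d root.
    by rewrite !grounded_root !addr0.
  by move/matrixP/(_ k 0): vE; rewrite !grounded_node !mxE => <-; rewrite subrKC.
(* The active and reactive parts superpose. Each Laplacian has inverse weights, so the inverse in
   [potential_drop] restores the resistance or reactance. *)
have drop (w : V -> V -> R) (g : V -> R) :
    (forall d k, e d k -> w d k = w k d) -> (forall d k, e d k -> 0 < w d k) ->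
    let z := invmx (reduced_laplacian G (fun d k => (w d k)^-1)) *m nonroot_vec G g in
    grounded z a - grounded z b = w a b * \sum_(d in descendants G a) g d.
  move=> w_sym w_gt0 z.
  have wV_sym d k : e d k -> (w d k)^-1 = (w k d)^-1 by move/w_sym->.
  have wV_gt0 d k : e d k -> 0 < (w d k)^-1.
    by move=> edk; rewrite invr_gt0 w_gt0.
  rewrite -[w a b]invrK; apply: (potential_drop wV_sym wV_gt0 _ ba).
  by rewrite /z mulKVmx //; exact: reduced_laplacian_unit.
rewrite -(drop _ p (@resistance_sym _ _ G) (@resistance_gt0 _ _ G)).
rewrite -(drop _ q (@reactance_sym _ _ G) (@reactance_gt0 _ _ G)).
by rewrite -/zp -/zq !vE opprD addrACA subrr add0r opprD addrACA.
Qed.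

End Flow.

(** * Covariance calculus for square-integrable variables *)

Section Statistics.
Context (d : measure_display) (T : measurableType d) (R : realType).
Context (P : probability T R).

Lemma L2_add (X Y : T -> R) :
  X \in Lfun P 2%:E -> Y \in Lfun P 2%:E -> X + Y \in Lfun P 2%:E.
Proof. by move=> X2 Y2; rewrite rpredD ?lee1n //=. Qed.

Lemma L2_sub (X Y : T -> R) :
  X \in Lfun P 2%:E -> Y \in Lfun P 2%:E -> X - Y \in Lfun P 2%:E.
Proof. by move=> X2 Y2; rewrite rpredB ?lee1n //=. Qed.

Lemma L2_scale (c : R) (X : T -> R) :
  X \in Lfun P 2%:E -> c \o* X \in Lfun P 2%:E.
Proof. by move=> X2; rewrite Lfun_scale ?ler1n. Qed.

Lemma L2_sum (V : finType) (A : {set V}) (X : V -> T -> R) :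
  (forall i, i \in A -> X i \in Lfun P 2%:E) ->
  \sum_(i in A) X i \in Lfun P 2%:E.
Proof.
move=> X2; apply: (big_ind (fun S : T -> R => S \in Lfun P 2%:E)) => //.
- exact: (Lfun_cst P 0).
- exact: L2_add.
Qed.

Lemma covariance_sumr (V : finType) (A : {set V}) (X : T -> R) (Y : V -> T -> R) :
  X \in Lfun P 2%:E -> (forall i, i \in A -> Y i \in Lfun P 2%:E) ->
  covariance P X (\sum_(i in A) Y i) = (\sum_(i in A) covariance P X (Y i))%E.
Proof.
move=> X2 Y2.
(* The induction also carries square integrability of the partial sums, which additivity of
   covariance requires. *)
suff [] : \sum_(i in A) Y i \in Lfun P 2%:E /\
  covariance P X (\sum_(i in A) Y i) = (\sum_(i in A) covariance P X (Y i))%E by [].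
apply: (big_rec2 (fun (S : T -> R) c => S \in Lfun P 2%:E /\ covariance P X S = c)).
  by split; [exact: (Lfun_cst P 0) | exact: (covariance_cst_r P X 0)].
move=> i S c iA [S2 <-]; split; first by rewrite L2_add ?Y2.
by rewrite -covarianceDr // Y2.
Qed.

Lemma variance_sum (V : finType) (A : {set V}) (X : V -> T -> R) :
  (forall i, i \in A -> X i \in Lfun P 2%:E) ->
  (forall i j, i \in A -> j \in A -> i != j -> covariance P (X i) (X j) = 0%E) ->
  variance P (\sum_(i in A) X i) = (\sum_(i in A) variance P (X i))%E.
Proof.
move=> X2 X_uncorr; rewrite /variance covariance_sumr ?L2_sum //.
apply: eq_bigr => i iA; rewrite covarianceC covariance_sumr ?X2 //.
rewrite (bigD1 i) //= big1 ?adde0 // => j /andP[jA ji].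
by apply: X_uncorr; rewrite // eq_sym.
Qed.

Lemma phi_variance (V : finType) (v : V -> T -> R) (e f : V) :
  v e \in Lfun P 1 -> v f \in Lfun P 1 ->
  phi P v e f = variance P (v e \- v f).
Proof.
move=> ve vf; rewrite /phi /variance covariance.unlock expectationB //.
rewrite fineB ?expectation_fin_num //; congr expectation; apply/funext => w /=.
rewrite expr2; have -> : forall x y s t : R, x - s - (y - t) = x - y - (s - t).
  by move=> x y s t; rewrite !opprB (addrC t) addrACA (addrC _ t).
by [].
Qed.

Lemma covariance_scale (X Y : T -> R) (s t : R) :
  X \in Lfun P 2%:E -> Y \in Lfun P 2%:E ->
  covariance P (s \o* X) (t \o* Y) = ((s * t)%:E * covariance P X Y)%E.
Proof.
move=> X2 Y2.
have L12 := Lfun_subset12 (fin_num_measure P _ measurableT).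
have tY2 := L2_scale t Y2.
rewrite covarianceZl; [|exact: L12|exact: L12|exact: Lfun2_mul_Lfun1].
rewrite covarianceZr; [|exact: L12|exact: L12|exact: Lfun2_mul_Lfun1].
by rewrite muleA EFinM.
Qed.

Lemma variance_lincomb (X Y : T -> R) (s t : R) :
  X \in Lfun P 2%:E -> Y \in Lfun P 2%:E ->
  variance P (s \o* X \+ t \o* Y) =
  ((s ^+ 2)%:E * variance P X + (t ^+ 2)%:E * variance P Y
   + (2 * s * t)%:E * covariance P X Y)%E.
Proof.
move=> X2 Y2; rewrite varianceD ?L2_scale // !varianceZ //.
by rewrite covariance_scale // muleA -EFinM mulrA.
Qed.

Lemma covariance_lincomb_eq0 (X Y Z W : T -> R) (s t s' t' : R) :
  X \in Lfun P 2%:E -> Y \in Lfun P 2%:E ->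
  Z \in Lfun P 2%:E -> W \in Lfun P 2%:E ->
  covariance P X Z = 0%E -> covariance P X W = 0%E ->
  covariance P Y Z = 0%E -> covariance P Y W = 0%E ->
  covariance P (s \o* X \+ t \o* Y) (s' \o* Z \+ t' \o* W) = 0%E.
Proof.
move=> X2 Y2 Z2 W2 XZ XW YZ YW.
rewrite covarianceDl ?L2_add ?L2_scale // !covarianceDr ?L2_scale //.
by rewrite !covariance_scale // XZ XW YZ YW !mule0 !adde0.
Qed.

End Statistics.

(** * Second moments of the voltage drops *)

Section RandomFlow.
Context (R : realType) (disp : measure_display).
Context (T : measurableType disp) (P : probability T R).
Context (V : finType) (G : radial_grid R V) (v0 : R) (p q v : V -> T -> R).
Local Notation root := (substation G).
Context (p_L2 : forall e : V, e != root -> p e \in Lfun P 2%:E).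
Context (q_L2 : forall e : V, e != root -> q e \in Lfun P 2%:E).
Context (uncorrelated : forall e f : V, e != root -> f != root -> e != f ->
  [/\ crosscov P p p e f = 0%E, crosscov P q q e f = 0%E &
      crosscov P q p e f = 0%E]).
Context (model : forall w : T, LCPF G v0 (p ^~ w) (q ^~ w) (v ^~ w)).

(** The share of the drop from [a] to its parent [b] caused by the injections at a descendant
    [d]. *)
Definition edge_load (a b d : V) : T -> R :=
  resistance G a b \o* p d \+ reactance G a b \o* q d.

Lemma edge_load_L2 (a b d : V) : d != root -> edge_load a b d \in Lfun P 2%:E.
Proof. by move=> d0; rewrite L2_add ?L2_scale ?p_L2 ?q_L2. Qed.

Lemma edge_load_uncorrelated (a b a' b' d d' : V) :
  d != root -> d' != root -> d != d' ->
  covariance P (edge_load a b d) (edge_load a' b' d') = 0%E.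
Proof.
move=> d0 d'0 dd'; have [pp qq qp] := uncorrelated d0 d'0 dd'.
(* The assumption covers the covariance of [q] with [p] only in this order; exchanging the two nodes
   gives that of [p] with [q]. *)
have [_ _ pq] : [/\ crosscov P p p d' d = 0%E, crosscov P q q d' d = 0%E &
  crosscov P q p d' d = 0%E] by apply: uncorrelated; rewrite // eq_sym.
by apply: covariance_lincomb_eq0; rewrite ?p_L2 ?q_L2 // covarianceC.
Qed.

Lemma voltage_drop_load (a b : V) : is_parent G b a ->
  v a \- v b = \sum_(d in descendants G a) edge_load a b d.
Proof.
move=> ba; apply/funext => w /=.
rewrite (LCPF_voltage_drop (model w) ba) fct_sumE !mulr_sumr -big_split /=.
by apply: eq_bigr => d _; rewrite /edge_load /= (mulrC _ (p d w)) (mulrC _ (q d w)).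
Qed.

(** Going down from the root, where the voltage is constant, each edge adds a finite sum of
    square-integrable loads. *)
Lemma voltage_L2 (a : V) : v a \in Lfun P 2%:E.
Proof.
have [n] := ubnP (size (root_path G a)); elim: n a => // n IHn a.
have [-> _|/exists_parent[b ba]] := eqVneq a root.
  have -> : v root = cst v0 by apply/funext => w; have [] := model w.
  by rewrite Lfun_cst.
rewrite (root_path_parent ba) ltnS => /IHn vb.
have -> : v a = v b + (v a \- v b) by apply/funext => w /=; rewrite addrC subrK.
rewrite L2_add // voltage_drop_load // L2_sum // => d dD.
by rewrite edge_load_L2 // (descendant_neq_root ba dD).
Qed.

Lemma voltage_drop_variance (a b : V) : is_parent G b a ->
  variance P (v a \- v b) =
  (\sum_(d in descendants G a)
     ((resistance G a b ^+ 2)%:E * crosscov P p p d d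
      + (reactance G a b ^+ 2)%:E * crosscov P q q d d
      + (2 * resistance G a b * reactance G a b)%:E * crosscov P p q d d))%E.
Proof.
move=> ba; have D0 := descendant_neq_root ba.
rewrite voltage_drop_load // variance_sum => [|d dD|d k dD kD dk].
- by apply: eq_bigr => d /D0 d0; rewrite variance_lincomb ?p_L2 ?q_L2.
- by rewrite edge_load_L2 ?D0.
- by rewrite edge_load_uncorrelated ?D0.
Qed.

(** Bilinearity leaves covariances of loads at pairs of nodes, one from each subtree; siblings have
    disjoint subtrees, so the nodes of each pair differ. *)
Lemma sibling_drops_uncorrelated (a b c : V) :
  a != c -> is_parent G b a -> is_parent G b c ->
  covariance P (v a \- v b) (v c \- v b) = 0%E.
Proof.
move=> ac ba bc; have Da0 := descendant_neq_root ba.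
have Dc0 := descendant_neq_root bc.
rewrite (voltage_drop_load bc) covariance_sumr => [||d /Dc0 d0]; last 2 first.
- by rewrite L2_sub ?voltage_L2.
- exact: edge_load_L2.
apply: big1 => k kc; rewrite covarianceC voltage_drop_load //.
rewrite covariance_sumr ?edge_load_L2 ?Dc0 // => [|d /Da0 d0]; last first.
  exact: edge_load_L2.
apply: big1 => d da; apply: edge_load_uncorrelated; [exact: Dc0|exact: Da0|].
by apply: contra_neq ac => kd; apply: (descendants_siblings ba bc da); rewrite -kd.
Qed.

End RandomFlow.

(** * Variance of the voltage difference between siblings *)

Theorem theorem1 (R : realType) (disp : measure_display)
    (T : measurableType disp) (P : probability T R)
    (V : finType) (G : radial_grid R V)
    (v0 : R) (p q v : V -> T -> R)
    (p_L2 : forall e : V, e != substation G -> p e \in Lfun P 2%:E)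
    (q_L2 : forall e : V, e != substation G -> q e \in Lfun P 2%:E)
    (uncorrelated : forall e f : V,
       e != substation G -> f != substation G -> e != f ->
       [/\ crosscov P p p e f = 0%E, crosscov P q q e f = 0%E &
           crosscov P q p e f = 0%E])
    (model : forall w : T, LCPF G v0 (p ^~ w) (q ^~ w) (v ^~ w))
    (a b c : V) (neq_ac : a != c)
    (parent_ba : is_parent G b a) (parent_bc : is_parent G b c) :
  let r := resistance G in
  let x := reactance G in
  phi P v a c =
    (\sum_(d in descendants G a)
        ((r a b ^+ 2)%:E * crosscov P p p d d
         + (x a b ^+ 2)%:E * crosscov P q q d d
         + (2 * r a b * x a b)%:E * crosscov P p q d d)
     + \sum_(d in descendants G c)
        ((r b c ^+ 2)%:E * crosscov P p p d d
         + (x b c ^+ 2)%:E * crosscov P q q d d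
         + (2 * r b c * x b c)%:E * crosscov P p q d d))%E
  /\ phi P v a c = (phi P v a b + phi P v b c)%E.
Proof.
move=> r x.
have v2 e : v e \in Lfun P 2%:E by apply: (voltage_L2 p_L2 q_L2 model).
have v1 e : v e \in Lfun P 1.
  exact: Lfun_subset12 (fin_num_measure P _ measurableT) _ (v2 e).
have vB2 e f : v e \- v f \in Lfun P 2%:E by rewrite L2_sub.
(* The statement orients the second edge from [b] to [c], the drop lemmas from child to parent;
   symmetry of the line parameters reconciles them. *)
have ebc : edge G b c by case/andP: parent_bc.
rewrite !phi_variance // /r /x (resistance_sym ebc) (reactance_sym ebc).
rewrite -(voltage_drop_variance p_L2 q_L2 uncorrelated model parent_ba).
rewrite -(voltage_drop_variance p_L2 q_L2 uncorrelated model parent_bc).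
have -> : v b \- v c = \- (v c \- v b) by apply/funext => w /=; rewrite opprB.
(* Through the common parent, the difference splits into two drops whose covariance vanishes. *)
have -> : v a \- v c = (v a \- v b) \- (v c \- v b).
  by apply/funext => w /=; rewrite opprB addrA subrK.
rewrite varianceN // varianceB //.
have -> := sibling_drops_uncorrelated p_L2 q_L2 uncorrelated model
  neq_ac parent_ba parent_bc.
by rewrite mule0 sube0.
Qed.
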